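(* Let $\alpha\in[0,\tfrac12]$ and $\gamma\in\mathbb{R}$ with $|\gamma|\le1$, let $h>0$ be the grid size and $\tau>0$ the time step size. Consider the explicit anisotropic diffusion scheme $$\boldsymbol{u}^{k+1}=\bigl(\boldsymbol{I}+\tau\,\boldsymbol{A}(\boldsymbol{u}^k)\bigr)\,\boldsymbol{u}^k,\qquad k=0,1,2,\dots,$$ where $\boldsymbol{I}$ is the unit matrix and, for each $k$, $\boldsymbol{A}(\boldsymbol{u}^k)$ is the symmetric matrix that applies the space-variant $\delta$-stencil with reflecting boundary conditions for diffusion tensors $\boldsymbol{D}_p=\begin{pmatrix} a_p & b_p\\ b_p & c_p\end{pmatrix}$ (possibly depending on $\boldsymbol{u}^k$) given at the staggered grid points $p$, real symmetric with eigenvalues $\lambda_1(p)\ge\lambda_2(p)\ge0$ and $\lambda_1(p)>0$, and with $$\delta_p=\alpha\,(a_p+c_p)+\beta_p\,b_p,\qquad \beta_p=\gamma\,(1-2\alpha)\,\mathrm{sgn}(b_p).$$ If $$\tau\;\le\;\frac{h^2}{2\,(1-\alpha)\,(\lambda_1(p)+\lambda_2(p))+\bigl(1-\gamma\,(1-2\alpha)\bigr)\,(\lambda_1(p)-\lambda_2(p))}$$ at all staggered grid points $p$ and all time levels $k$, then the scheme is stable in the Euclidean norm, that is, $\|\boldsymbol{u}^{k+1}\|_2\le\|\boldsymbol{u}^k\|_2$ for all $k\ge0$.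
   Context: Setting. A discrete image is $\boldsymbol{u}=(u_{i,j})$ with $1\le i\le n_1$, $1\le j\le n_2$, regarded as a vector in $\mathbb{R}^N$, $N=n_1n_2$; the grid size is $h>0$ in both directions. Staggered grid points are the points $(i+\tfrac12,j+\tfrac12)$ with $0\le i\le n_1$, $0\le j\le n_2$. At each of them a real symmetric positive semidefinite matrix (diffusion tensor) $\boldsymbol{D}=\begin{pmatrix} a & b \\ b & c \end{pmatrix}$ is given (it may vary from point to point, and it may depend on the current image $\boldsymbol{u}^k$), together with a real number $\delta$. Subscripts denote evaluation at a point. Values at the points $(i\pm\tfrac12,j)$ and $(i,j\pm\tfrac12)$ are defined by averaging: $$(a-\delta)_{i\pm\frac12,j}=\tfrac12\bigl((a-\delta)_{i\pm\frac12,j+\frac12}+(a-\delta)_{i\pm\frac12,j-\frac12}\bigr),$$ $$(c-\delta)_{i,j\pm\frac12}=\tfrac12\bigl((c-\delta)_{i+\frac12,j\pm\frac12}+(c-\delta)_{i-\frac12,j\pm\frac12}\bigr).$$ The $\delta$-stencil (a discretisation of $\mathrm{div}(\boldsymbol{D}\,\nabla u)$) defines, for given tensors and given $\delta$, the linear map $\boldsymbol{A}$ by $$\begin{aligned}(\boldsymbol{A}\boldsymbol{u})_{i,j}=\frac1{h^2}\Bigl[&(a-\delta)_{i+\frac12,j}(u_{i+1,j}-u_{i,j})+(a-\delta)_{i-\frac12,j}(u_{i-1,j}-u_{i,j})\\ &+(c-\delta)_{i,j+\frac12}(u_{i,j+1}-u_{i,j})+(c-\delta)_{i,j-\frac12}(u_{i,j-1}-u_{i,j})\\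 &+\tfrac12(\delta+b)_{i+\frac12,j+\frac12}(u_{i+1,j+1}-u_{i,j})+\tfrac12(\delta+b)_{i-\frac12,j-\frac12}(u_{i-1,j-1}-u_{i,j})\\ &+\tfrac12(\delta-b)_{i-\frac12,j+\frac12}(u_{i-1,j+1}-u_{i,j})+\tfrac12(\delta-b)_{i+\frac12,j-\frac12}(u_{i+1,j-1}-u_{i,j})\Bigr].\end{aligned}$$ Reflecting boundary conditions: values outside the image are obtained by mirroring, i.e. $u_{0,j}=u_{1,j}$, $u_{n_1+1,j}=u_{n_1,j}$, $u_{i,0}=u_{i,1}$, $u_{i,n_2+1}=u_{i,n_2}$ (applied in both directions at the corners), and, consistently with mirroring, $b=0$ at the boundary staggered points (those with $i\in\{0,n_1\}$ or $j\in\{0,n_2\}$). With these conventions $\boldsymbol{A}$ is a symmetric $N\times N$ matrix. $\boldsymbol{A}(\boldsymbol{u}^k)$ denotes the matrix $\boldsymbol{A}$ built from the tensors and values of $\delta$ at time level $k$. $\mathrm{sgn}$ is the sign function, with $\mathrm{sgn}(0)=0$ (the value at $0$ is irrelevant since only $\beta b$ enters). *)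

(* Defs.v *)
From HB Require Import structures.
From mathcomp Require Import all_boot all_order all_algebra.
From mathcomp Require Import reals ring.

Set Implicit Arguments.
Unset Strict Implicit.
Unset Printing Implicit Defensive.

Import Order.TTheory GRing.Theory Num.Theory.
Local Open Scope ring_scope.

Definition norm2 (R : realType) (n : nat) (x : 'cV[R]_n) : R :=
  Num.sqrt (\sum_i x i 0 ^+ 2).

(* Indices are shifted so that they start at 0: [i : 'I_n] is the pixel
   coordinate i + 1 in 1..n, and [s : 'I_n.+1] is the staggered coordinate
   s + 1/2 with s in 0..n.  Hence the staggered coordinates half a cell before
   and after the pixel coordinate [i] are [before i] and [after i]. *)
Definition before (n : nat) (i : 'I_n) : 'I_n.+1 := widen_ord (leqnSn n) i.
Definition after (n : nat) (i : 'I_n) : 'I_n.+1 := lift ord0 i.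

(* Neighbouring pixel coordinates with mirroring: [insubd i k] is the ordinal
   [k] if k < n and [i] otherwise, so [next] fixes the last pixel; [prev]
   fixes pixel 0 because 0.-1 = 0. *)
Definition prev (n : nat) (i : 'I_n) : 'I_n := insubd i i.-1.
Definition next (n : nat) (i : 'I_n) : 'I_n := insubd i i.+1.

Definition on_boundary (n : nat) (s : 'I_n.+1) : bool :=
  (s == ord0) || (s == ord_max).

Definition tensor_field (R : realType) (n1 n2 : nat) : Type :=
  'I_n1.+1 -> 'I_n2.+1 -> 'M[R]_2.

Definition ta (R : realType) (D : 'M[R]_2) : R := D 0 0.
Definition tb (R : realType) (D : 'M[R]_2) : R := D 0 1.
Definition tc (R : realType) (D : 'M[R]_2) : R := D 1 1.

Definition offdiag_vanishes_on_boundary (R : realType) (n1 n2 : nat)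
    (D : tensor_field R n1 n2) : Prop :=
  forall s t, on_boundary s || on_boundary t -> tb (D s t) = 0.

Definition delta_stencil (R : realType) (n1 n2 : nat) (h : R)
    (D : tensor_field R n1 n2) (delta : 'I_n1.+1 -> 'I_n2.+1 -> R)
    (u : 'M[R]_(n1, n2)) : 'M[R]_(n1, n2) :=
  let b s t := tb (D s t) in
  let a_delta s j := 2^-1 * ((ta (D s (after j)) - delta s (after j))
                             + (ta (D s (before j)) - delta s (before j))) in
  let c_delta i t := 2^-1 * ((tc (D (after i) t) - delta (after i) t)
                             + (tc (D (before i) t) - delta (before i) t)) in
  \matrix_(i, j) ((h ^+ 2)^-1 *
    (  a_delta (after i) j * (u (next i) j - u i j)
     + a_delta (before i) j * (u (prev i) j - u i j)
     + c_delta i (after j) * (u i (next j) - u i j)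
     + c_delta i (before j) * (u i (prev j) - u i j)
     + 2^-1 * (delta (after i) (after j) + b (after i) (after j))
         * (u (next i) (next j) - u i j)
     + 2^-1 * (delta (before i) (before j) + b (before i) (before j))
         * (u (prev i) (prev j) - u i j)
     + 2^-1 * (delta (before i) (after j) - b (before i) (after j))
         * (u (prev i) (next j) - u i j)
     + 2^-1 * (delta (after i) (before j) - b (after i) (before j))
         * (u (next i) (prev j) - u i j))).

(* [lin_mx] represents a linear map by right multiplication on row vectors;
   images are column vectors here, hence the transpose. *)
Definition stencil_mx (R : realType) (n1 n2 : nat) (h : R)
    (D : tensor_field R n1 n2) (delta : 'I_n1.+1 -> 'I_n2.+1 -> R) :
    'M[R]_(n1 * n2) :=
  (lin_mx (delta_stencil h D delta))^T.

Lemma delta_stencil_is_linear (R : realType) (n1 n2 : nat) (h : R)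
    (D : tensor_field R n1 n2) (delta : 'I_n1.+1 -> 'I_n2.+1 -> R) :
  linear (delta_stencil h D delta).
Proof. by move=> k u v; apply/matrixP => i j; rewrite !mxE; ring. Qed.

HB.instance Definition _ (R : realType) (n1 n2 : nat) (h : R)
    (D : tensor_field R n1 n2) (delta : 'I_n1.+1 -> 'I_n2.+1 -> R) :=
  GRing.isLinear.Build R 'M[R]_(n1, n2) 'M[R]_(n1, n2) *:%R
    (delta_stencil h D delta) (delta_stencil_is_linear h D delta).

Lemma stencil_mxE (R : realType) (n1 n2 : nat) (h : R)
    (D : tensor_field R n1 n2) (delta : 'I_n1.+1 -> 'I_n2.+1 -> R)
    (u : 'M[R]_(n1, n2)) :
  stencil_mx h D delta *m (mxvec u)^T = (mxvec (delta_stencil h D delta u))^T.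
Proof. by rewrite /stencil_mx -trmx_mul mul_vec_lin. Qed.

Definition delta_of (R : realType) (alpha gamma : R) (D : 'M[R]_2) : R :=
  let beta := gamma * (1 - 2 * alpha) * Num.sg (tb D) in
  alpha * (ta D + tc D) + beta * tb D.

Definition diffusion_mx (R : realType) (n1 n2 : nat) (h alpha gamma : R)
    (D : tensor_field R n1 n2) : 'M[R]_(n1 * n2) :=
  stencil_mx h D (fun s t => delta_of alpha gamma (D s t)).

(* Eigenvalues counted with multiplicity. *)
Definition has_eigenvalues (R : realType) (D : 'M[R]_2) (l1 l2 : R) : Prop :=
  char_poly D = ('X - l1%:P) * ('X - l2%:P).

(* Main.v *)
Require Import Defs.
From HB Require Import structures.
From mathcomp Require Import all_boot all_order all_algebra.
From mathcomp Require Import reals.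
From mathcomp Require Import ring lra.

Set Implicit Arguments.
Unset Strict Implicit.
Unset Printing Implicit Defensive.

Import Order.TTheory GRing.Theory Num.Theory.
Local Open Scope ring_scope.

(** Group the stencil by dual cells: a staggered point [p] is the centre of a
    cell with four (possibly mirrored) pixel corners, and the stencil at a pixel
    is h^-2 times the sum of the fluxes [g] that the pixel receives from its
    four cells ([delta_stencil_corner_flux]).  With theta = tau / h^2, the
    Cauchy-Schwarz inequality (g1 + .. + g4)^2 <= 4 (g1^2 + .. + g4^2) gives at
    each pixel of value [v]

      (v + theta (g1 + .. + g4))^2
        <= v^2 - 2 theta (sum of the four [slack theta v g]),

    where [slack theta v g] = - v g - 2 theta g^2.  The norm therefore cannot
    grow if the slacks, summed over all pixels and their cells, have a
    nonnegative total ([stencil_step_nonexpansive]).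

    That total is regrouped by cells.  An interior cell contributes its four
    corners.  At the boundary only the corners inside the image are summed, but
    since [b] vanishes there, the configuration is symmetric under mirroring, so
    the real corners carry exactly a half or a quarter of the full cell sum
    ([sum_corner_slack_ge0]).  It remains to show that each full cell sum is
    nonnegative ([cell_slack_ge0]).

    On a cell the flux is - M applied to the corner values, for a symmetric 4x4
    matrix M, and the sum of the slacks is the quadratic form of M - 2 theta M^2.
    The matrix M kills constants, has the checkerboard pattern as eigenvector
    with eigenvalue a + c - 2 delta, and acts on the two diagonal differences
    like a matrix with the trace and determinant of the diffusion tensor, hence
    with eigenvalues lambda1 and lambda2.  So one needs these eigenvalues to lie
    in [0, 1 / (2 theta)].  The choice of delta makes a + c - 2 delta
    nonnegative, and the denominator of the step size bound dominates both
    2 lambda1 and 2 (a + c - 2 delta) ([double_eigenvalue_le],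
    [double_checkerboard_le]), because 2 |b| <= lambda1 - lambda2. *)

(** * Symmetric 2x2 matrices *)

Lemma eigenvalues2_trace (R : realType) (D : 'M[R]_2) (l1 l2 : R) :
  has_eigenvalues D l1 l2 -> ta D + tc D = l1 + l2.
Proof.
move=> hD; have := char_poly_trace D (isT : (0 < 2)%N).
rewrite hD /mxtrace big_ord_recl big_ord1 (_ : lift _ _ = 1); last exact/val_inj.
by rewrite mulrBl !mulrBr !coefE /= -/(ta D) -/(tc D) => ?; lra.
Qed.

Lemma eigenvalues2_det (R : realType) (D : 'M[R]_2) (l1 l2 : R) :
  D^T = D -> has_eigenvalues D l1 l2 -> ta D * tc D - tb D ^+ 2 = l1 * l2.
Proof.
move=> hsym hD; have D10 : D 1 0 = D 0 1 by rewrite -[in LHS]hsym mxE.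
have := char_poly_det D; rewrite hD sqrrN expr1n mul1r.
rewrite (expand_det_row D 0) big_ord_recl big_ord1 /cofactor !det_mx11 !mxE.
have -> : lift ord0 (0 : 'I_1) = 1 :> 'I_2 by exact/val_inj.
have -> : lift 1 (0 : 'I_1) = 0 :> 'I_2 by exact/val_inj.
rewrite mulrBl !mulrBr !coefE /= D10 -/(ta D) -/(tb D) -/(tc D).
by rewrite -[(0 + 1 %% 2)%N]/1%N expr0 expr1 => e; lra.
Qed.

Lemma degenerate_form2_ge0 (R : realType) (P B S x y : R) :
  0 <= P + S -> P * S = B ^+ 2 ->
  0 <= P * x ^+ 2 + 2 * B * x * y + S * y ^+ 2.
Proof.
move=> tr_ge0 det0.
have [tr_gt0|] := ltP 0 (P + S).
  rewrite -(pmulr_rge0 _ tr_gt0).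
  rewrite (_ : (P + S) * _ = (P * x + B * y) ^+ 2 + (B * x + S * y) ^+ 2).
    by rewrite addr_ge0 ?sqr_ge0.
  by ring: det0.
move=> tr_le0; have SE : S = - P by lra.
have P0 : P = 0 by rewrite SE in det0; nra.
have B0 : B = 0 by rewrite SE P0 in det0; nra.
by rewrite SE P0 B0; lra.
Qed.

(** Cayley-Hamilton for the matrix M with rows (P, B) and (B, S) reads
    M^2 = l1 M - l2 (l1 - M), so |M v|^2 <= l1 (M v, v) as soon as [l1 - M] is
    positive semidefinite.  Both [l1 - M] and [M - l2] are degenerate with
    nonnegative trace, which gives their positivity without diagonalising M. *)
Lemma image_norm_le_form2 (R : realType) (P B S l1 l2 theta x y : R) :
  P + S = l1 + l2 -> P * S - B ^+ 2 = l1 * l2 -> 0 <= l2 <= l1 ->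
  0 <= theta -> 2 * theta * l1 <= 1 ->
  2 * theta * ((P * x + B * y) ^+ 2 + (B * x + S * y) ^+ 2) <=
  P * x ^+ 2 + 2 * B * x * y + S * y ^+ 2.
Proof.
move=> tr det /andP[l2_ge0 l21] theta_ge0 thetal1.
have PE : P = l1 + l2 - S by lra.
have BE : B ^+ 2 = (l1 + l2 - S) * S - l1 * l2 by rewrite -PE; lra.
set Q := (X in _ <= X).
have Q_le : 0 <= (l1 - P) * x ^+ 2 + 2 * (- B) * x * y + (l1 - S) * y ^+ 2.
  apply: degenerate_form2_ge0; first by lra.
  by rewrite sqrrN BE PE; ring.
have Q_ge : 0 <= (P - l2) * x ^+ 2 + 2 * B * x * y + (S - l2) * y ^+ 2.
  apply: degenerate_form2_ge0; first by lra.
  by rewrite BE PE; ring.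
have Q_ge0 : 0 <= Q.
  have := mulr_ge0 l2_ge0 (addr_ge0 (sqr_ge0 x) (sqr_ge0 y)); rewrite /Q; lra.
(* Cayley-Hamilton, contracted twice with the vector (x, y) *)
have CH : (P * x + B * y) ^+ 2 + (B * x + S * y) ^+ 2 =
    l1 * Q - l2 * (l1 * (x ^+ 2 + y ^+ 2) - Q).
  by rewrite /Q PE; ring: BE.
have im_le : (P * x + B * y) ^+ 2 + (B * x + S * y) ^+ 2 <= l1 * Q.
  rewrite CH gerBl mulr_ge0 // /Q; lra.
apply: (le_trans (ler_wpM2l _ im_le)); first lra.
by rewrite mulrA ler_piMl.
Qed.

(** * Fluxes inside one dual cell *)

(** One cell's share of h^2 times the stencil, at a corner on the main diagonal
    of the cell; a corner on the antidiagonal needs [- b] in place of [b].  The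
    global factor 1/2 comes from the averaging of [a] and [c] on cell edges. *)
Definition cell_flux (R : realType) (a b c d v vx vy vd : R) : R :=
  2^-1 * ((a - d) * (vx - v) + (c - d) * (vy - v) + (d + b) * (vd - v)).

(** Up to the factor 2 theta, the decrease of the squared pixel value that the
    Cauchy-Schwarz inequality guarantees for one of the four fluxes. *)
Definition slack (R : realType) (theta v g : R) : R :=
  - (v * g) - 2 * theta * g ^+ 2.

(** Decomposition along the eigenspaces of the cell matrix: the checkerboard
    component p - q - r + s has eigenvalue a + c - 2 d, and the diagonal
    differences (p - s, q - r) are mixed by the matrix with rows (P, B) and
    (B, S) below, which has the eigenvalues of the tensor. *)
Lemma cell_slack_ge0 (R : realType) (a b c d l1 l2 theta p q r s : R) :
  a + c = l1 + l2 -> a * c - b ^+ 2 = l1 * l2 -> 0 <= l2 <= l1 ->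
  0 <= theta -> 2 * theta * l1 <= 1 ->
  0 <= a + c - 2 * d -> 2 * theta * (a + c - 2 * d) <= 1 ->
  0 <= slack theta p (cell_flux a b c d p q r s)
     + slack theta r (cell_flux a (- b) c d r s p q)
     + (slack theta q (cell_flux a (- b) c d q p s r)
     + slack theta s (cell_flux a b c d s r q p)).
Proof.
move=> tr det l12 theta_ge0 thetal1 kappa_ge0 thetakappa.
set kappa := a + c - 2 * d in kappa_ge0 thetakappa.
pose P := (a + c) / 2 + b; pose S := (a + c) / 2 - b; pose B := (c - a) / 2.
have trPS : P + S = l1 + l2 by rewrite /P /S; lra.
have detPS : P * S - B ^+ 2 = l1 * l2 by rewrite /P /S /B -det; field.
have := @image_norm_le_form2 _ _ _ _ _ _ theta (p - s) (q - r)
  trPS detPS l12 theta_ge0 thetal1.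
rewrite -subr_ge0; set E := (X in 0 <= X) => E_ge0.
rewrite [X in 0 <= X](_ : _ =
    kappa * (1 - 2 * theta * kappa) * (p - q - r + s) ^+ 2 / 4 + E / 2).
  by rewrite addr_ge0 // divr_ge0 // mulr_ge0 ?sqr_ge0 // mulr_ge0 // subr_ge0.
by rewrite /E /P /S /B /slack /cell_flux /kappa; field.
Qed.

(** * Regrouping pixels by dual cells *)

(** The pixel on the high or low side of a staggered coordinate, with
    mirroring: the truncations [minn s n] and [s.-1] make both sides of a
    boundary coordinate coincide. *)
Definition side_pixel (n : nat) (s : 'I_n.+2) (e : bool) : 'I_n.+1 :=
  inord (if e then minn s n else s.-1).

Section SidePixel.
Variable n : nat.
Implicit Types (i : 'I_n.+1) (s : 'I_n.+2).

Lemma side_pixel_after_low i : side_pixel (after i) false = i.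
Proof. by rewrite /side_pixel lift0 /= inord_val. Qed.

Lemma side_pixel_before_high i : side_pixel (before i) true = i.
Proof. by rewrite /side_pixel /= (minn_idPl _) ?inord_val // -ltnS. Qed.

Lemma side_pixel_after_high i : side_pixel (after i) true = Defs.next i.
Proof.
apply: ord_inj; rewrite /side_pixel lift0 inordK ?ltnS ?geq_minr // val_insubd.
have [lt_in|] := ltnP i.+1 n.+1; first exact/minn_idPl.
rewrite ltnS => le_ni; rewrite (minn_idPr (leqW le_ni)).
by apply/eqP; rewrite eqn_leq le_ni -ltnS ltn_ord.
Qed.

Lemma side_pixel_before_low i : side_pixel (before i) false = Defs.prev i.
Proof.
have lt_i : (i.-1 < n.+1)%N by rewrite (leq_ltn_trans (leq_pred i)).
by apply: ord_inj; rewrite inordK // val_insubd lt_i.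
Qed.

Lemma side_pixel_mirror s e : on_boundary s -> side_pixel s e = side_pixel s false.
Proof.
by case: e => // /orP[] /eqP ->; rewrite /side_pixel /= ?min0n ?(minn_idPr _).
Qed.
End SidePixel.

(** Each pixel is the low side of the staggered coordinate after it and the high
    side of the one before it, so summing over pixels sees both sides of interior
    coordinates, but only the inner side of the two boundary ones.  By mirror
    symmetry this inner side is half of a nonnegative quantity. *)
Lemma sum_pixel_sides_ge0 (R : realType) (n : nat) (G : 'I_n.+2 -> bool -> R) :
  (forall s, on_boundary s -> G s true = G s false) ->
  (forall s, 0 <= G s false + G s true) ->
  0 <= \sum_(i < n.+1) (G (after i) false + G (before i) true).
Proof.
move=> mirror G_ge0.
have half e s : on_boundary s -> 0 <= G s e.
  by move=> /mirror Gs; have := G_ge0 s; case: e; rewrite Gs; lra.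
rewrite big_split /= big_ord_recr [X in _ + X]big_ord_recl /=.
rewrite [X in _ + X]addrC addrACA -big_split /= addr_ge0 //.
- apply: sumr_ge0 => i _.
  rewrite (_ : before _ = after (widen_ord (leqnSn n) i)) //.
  exact: val_inj.
- by apply: addr_ge0; apply: half; apply/orP; [right | left]; exact/eqP/val_inj.
Qed.

(** * Nonexpansivity of one step *)

Section StencilStability.
Variables (R : realType) (m1 m2 : nat) (h theta : R).
Variables (D : tensor_field R m1.+1 m2.+1) (delta : 'I_m1.+2 -> 'I_m2.+2 -> R).
Variable u : 'M[R]_(m1.+1, m2.+1).

(** Booleans select a corner of the cell at (s, t): [e] for the first
    coordinate, [f] for the second, [true] meaning the high side. *)
Definition corner_value s t e f := u (side_pixel s e) (side_pixel t f).

Definition corner_flux s t e f :=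
  cell_flux (ta (D s t)) (if e == f then tb (D s t) else - tb (D s t))
    (tc (D s t)) (delta s t) (corner_value s t e f) (corner_value s t (~~ e) f)
    (corner_value s t e (~~ f)) (corner_value s t (~~ e) (~~ f)).

Definition corner_slack s t e f :=
  slack theta (corner_value s t e f) (corner_flux s t e f).

Lemma delta_stencil_corner_flux i j :
  delta_stencil h D delta u i j = (h ^+ 2)^-1 *
    (corner_flux (after i) (after j) false false
     + corner_flux (after i) (before j) false true
     + (corner_flux (before i) (after j) true false
        + corner_flux (before i) (before j) true true)).
Proof.
rewrite mxE /corner_flux /corner_value /cell_flux /=.
rewrite !side_pixel_after_low !side_pixel_after_high.
rewrite !side_pixel_before_low !side_pixel_before_high.
by congr (_ * _); ring.
Qed.

Hypothesis bdry : offdiag_vanishes_on_boundary D.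

(** Mirroring exchanges the diagonal with the antidiagonal of a cell, hence
    replaces [b] by [- b]: the symmetry holds because [b] vanishes there. *)
Lemma corner_slack_mirror_row s t f : on_boundary s ->
  corner_slack s t true f = corner_slack s t false f.
Proof.
move=> hs; rewrite /corner_slack /corner_flux /corner_value.
by rewrite bdry ?hs //= !(side_pixel_mirror true hs) oppr0 !if_same.
Qed.

Lemma corner_slack_mirror_col s t e : on_boundary t ->
  corner_slack s t e true = corner_slack s t e false.
Proof.
move=> ht; rewrite /corner_slack /corner_flux /corner_value.
by rewrite bdry ?ht ?orbT //= !(side_pixel_mirror true ht) oppr0 !if_same.
Qed.

Hypothesis cell_ge0 : forall s t,
  0 <= corner_slack s t false false + corner_slack s t false true
     + (corner_slack s t true false + corner_slack s t true true).

(** The one-dimensional regrouping is applied to the rows, and then, inside the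
    resulting cell sums, to the columns. *)
Lemma sum_corner_slack_ge0 :
  0 <= \sum_i \sum_j
    (corner_slack (after i) (after j) false false
     + corner_slack (after i) (before j) false true
     + (corner_slack (before i) (after j) true false
        + corner_slack (before i) (before j) true true)).
Proof.
pose G s e := \sum_j (corner_slack s (after j) e false
                      + corner_slack s (before j) e true).
under eq_bigr do rewrite big_split /=.
apply: (@sum_pixel_sides_ge0 _ _ G) => [s hs|s]; rewrite /G.
  by apply: eq_bigr => j _; rewrite !corner_slack_mirror_row.
rewrite -big_split /=; under eq_bigr do rewrite addrACA.
apply: (@sum_pixel_sides_ge0 _ _
  (fun t f => corner_slack s t false f + corner_slack s t true f)) => [t ht|t].
  by rewrite !corner_slack_mirror_col.
by rewrite addrACA.
Qed.

Lemma stencil_step_nonexpansive (tau : R) : 0 <= theta -> theta = tau / h ^+ 2 ->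
  \sum_i \sum_j (u + tau *: delta_stencil h D delta u) i j ^+ 2 <=
  \sum_i \sum_j u i j ^+ 2.
Proof.
move=> theta_ge0 thetaE; rewrite -subr_ge0.
apply: le_trans (mulr_ge0 (mulr_ge0 (ler0n _ 2) theta_ge0) sum_corner_slack_ge0) _.
rewrite mulr_sumr -sumrB; apply: ler_sum => i _.
rewrite mulr_sumr -sumrB; apply: ler_sum => j _.
have -> : (u + tau *: delta_stencil h D delta u) i j =
    u i j + tau * delta_stencil h D delta u i j by rewrite !mxE.
rewrite delta_stencil_corner_flux mulrA -thetaE /corner_slack.
rewrite /corner_value !side_pixel_after_low !side_pixel_before_high.
set g1 := corner_flux _ _ _ _; set g2 := corner_flux _ _ _ _.
set g3 := corner_flux _ _ _ _; set g4 := corner_flux _ _ _ _.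
(* Lagrange's identity for the Cauchy-Schwarz defect of four terms *)
rewrite -subr_ge0 [X in 0 <= X](_ : _ = theta ^+ 2 *
   ((g1 - g2) ^+ 2 + (g1 - g3) ^+ 2 + (g1 - g4) ^+ 2
    + (g2 - g3) ^+ 2 + (g2 - g4) ^+ 2 + (g3 - g4) ^+ 2)).
  by rewrite mulr_ge0 ?addr_ge0 ?sqr_ge0.
by rewrite /slack; ring.
Qed.
End StencilStability.

(** * Consequences of the choice of delta *)

Section DeltaBounds.
Variables (R : realType) (alpha gamma l1 l2 : R) (D : 'M[R]_2).
Hypotheses (halpha : 0 <= alpha <= 2^-1) (hgamma : `|gamma| <= 1).
Hypotheses (hsym : D^T = D) (heig : has_eigenvalues D l1 l2).
Hypothesis hl12 : 0 <= l2 <= l1.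

Let kappa := ta D + tc D - 2 * delta_of alpha gamma D.
Let K := 2 * (1 - alpha) * (l1 + l2) + (1 - gamma * (1 - 2 * alpha)) * (l1 - l2).

(** (l1 - l2)^2 - 4 b^2 is the discriminant of the characteristic polynomial
    minus 4 b^2, that is, (a - c)^2. *)
Lemma offdiag_le_gap : 2 * `|tb D| <= l1 - l2.
Proof.
have tr := eigenvalues2_trace heig; have det := eigenvalues2_det hsym heig.
have /andP[l2_ge0 l21] := hl12.
rewrite -ler_sqr ?nnegrE ?mulr_ge0 ?subr_ge0 // exprMn real_normK ?num_real //.
rewrite -subr_ge0 (_ : _ - _ = (ta D - tc D) ^+ 2) ?sqr_ge0 //.
have -> : (l1 - l2) ^+ 2 = (l1 + l2) ^+ 2 - 4 * (l1 * l2) by ring.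
by rewrite -tr -det; ring.
Qed.

Lemma checkerboardE : kappa =
  (1 - 2 * alpha) * (l1 + l2 - 2 * (gamma * `|tb D|)).
Proof.
rewrite /kappa /delta_of (eigenvalues2_trace heig) -!mulrA -normrEsg; ring.
Qed.

Lemma gamma_mul_le (x y : R) : `|x| <= y -> gamma * x <= y.
Proof.
move=> xy; apply: le_trans (ler_norm _) _; rewrite normrM.
by apply: le_trans xy; rewrite ler_piMl.
Qed.

Lemma checkerboard_ge0 : 0 <= kappa.
Proof.
have /andP[l2_ge0 l21] := hl12; have /andP[_ a_le] := halpha.
have gamma_b : gamma * `|tb D| <= `|tb D| by rewrite gamma_mul_le ?normr_id.
have gap := offdiag_le_gap.
rewrite checkerboardE mulr_ge0 //; lra.
Qed.

(** [K] is affine in [alpha] and equals 2 l1 at alpha = 1/2; the excess is a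
    nonnegative multiple of 1 - 2 alpha since gamma (l1 - l2) <= l1 - l2. *)
Lemma double_eigenvalue_le : 2 * l1 <= K.
Proof.
have /andP[l2_ge0 l21] := hl12; have /andP[_ a_le] := halpha.
have gamma_gap : gamma * (l1 - l2) <= l1 - l2.
  by rewrite gamma_mul_le // ger0_norm ?subr_ge0.
have -> : K = 2 * l1 + (1 - 2 * alpha) * ((l1 + l2) - gamma * (l1 - l2)).
  by rewrite /K; ring.
rewrite lerDl mulr_ge0 //; lra.
Qed.

(** The sign of [gamma] decides which value of [|b|] is the worst one in
    [0, (l1 - l2) / 2]; both extremes are covered by
    |l1 - l2 - 4 |b|| <= l1 - l2. *)
Lemma double_checkerboard_le : 2 * kappa <= K.
Proof.
have /andP[l2_ge0 l21] := hl12; have /andP[a_ge0 a_le] := halpha.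
have gap := offdiag_le_gap; have b_ge0 := normr_ge0 (tb D).
have gamma_gap : gamma * (l1 - l2 - 4 * `|tb D|) <= l1 - l2.
  by apply: gamma_mul_le; rewrite ler_norml; apply/andP; split; lra.
have -> : K = 2 * kappa + (4 * alpha * l1 +
    (1 - 2 * alpha) * (l1 - l2 - gamma * (l1 - l2 - 4 * `|tb D|))).
  by rewrite checkerboardE /K; ring.
by rewrite lerDl addr_ge0 // ?mulr_ge0 //; lra.
Qed.
End DeltaBounds.

(** * The scheme *)

Lemma norm2_mxvec (R : realType) (n1 n2 : nat) (u : 'M[R]_(n1, n2)) :
  norm2 (mxvec u)^T = Num.sqrt (\sum_i \sum_j u i j ^+ 2).
Proof.
congr Num.sqrt; rewrite pair_bigA /=.
rewrite (reindex _ (curry_mxvec_bij n1 n2)) /=.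
by apply: eq_bigr => -[i j] _; rewrite mxE mxvecE.
Qed.

Theorem corollary1 (R : realType) (n1 n2 : nat)
  (hn1 : (0 < n1)%N) (hn2 : (0 < n2)%N)
  (alpha gamma h tau : R)
  (halpha : 0 <= alpha <= 2^-1) (hgamma : `|gamma| <= 1)
  (hh : 0 < h) (htau : 0 < tau)
  (D : nat -> 'cV[R]_(n1 * n2) -> tensor_field R n1 n2)
  (u : nat -> 'cV[R]_(n1 * n2))
  (lambda1 lambda2 : nat -> 'I_n1.+1 -> 'I_n2.+1 -> R)
  (hsym : forall k s t, (D k (u k) s t)^T = D k (u k) s t)
  (heig : forall k s t,
     has_eigenvalues (D k (u k) s t) (lambda1 k s t) (lambda2 k s t))
  (hlambda12 : forall k s t, lambda2 k s t <= lambda1 k s t)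
  (hlambda2 : forall k s t, 0 <= lambda2 k s t)
  (hlambda1 : forall k s t, 0 < lambda1 k s t)
  (hbdry : forall k, offdiag_vanishes_on_boundary (D k (u k)))
  (hscheme : forall k,
     u k.+1 = (1%:M + tau *: diffusion_mx h alpha gamma (D k (u k))) *m u k)
  (hstep : forall k s t,
     tau <= h ^+ 2 /
       (2 * (1 - alpha) * (lambda1 k s t + lambda2 k s t)
        + (1 - gamma * (1 - 2 * alpha)) * (lambda1 k s t - lambda2 k s t))) :
  forall k, norm2 (u k.+1) <= norm2 (u k).
Proof.
(* the sides of a staggered coordinate are defined for images of positive size *)
case: n1 n2 hn1 hn2 D u lambda1 lambda2 hsym heig hlambda12 hlambda2 hlambda1
  hbdry hscheme hstep => [//|m1] [//|m2] _ _ D u lambda1 lambda2 hsym heig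
  hlambda12 hlambda2 hlambda1 hbdry hscheme hstep k.
pose U := vec_mx (u k)^T; pose Dk := D k (u k).
have uE : u k = (mxvec U)^T by rewrite vec_mxK trmxK.
pose dk s t := delta_of alpha gamma (Dk s t).
have -> : u k.+1 = (mxvec (U + tau *: delta_stencil h Dk dk U))^T.
  rewrite linearD linearZ /= linearD linearZ /= -stencil_mxE -uE hscheme.
  by rewrite mulmxDl mul1mx -scalemxAl.
rewrite uE !norm2_mxvec ler_wsqrtr //.
have h2_gt0 : 0 < h ^+ 2 by rewrite exprn_gt0.
have theta_ge0 : 0 <= tau / h ^+ 2 by rewrite divr_ge0 ?ltW.
apply: (@stencil_step_nonexpansive _ _ _ _ (tau / h ^+ 2)) => //; first exact: hbdry.
move=> s t.
have l12 : 0 <= lambda2 k s t <= lambda1 k s t by rewrite hlambda2 hlambda12.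
have dl1 := double_eigenvalue_le halpha hgamma l12.
have dkappa := double_checkerboard_le halpha hgamma (hsym k s t) (heig k s t) l12.
have := hstep k s t; set K := (X in _ <= _ / X) => tauK.
have K_gt0 : 0 < K by apply: lt_le_trans dl1; rewrite mulr_gt0.
have thetaK x : 2 * x <= K -> 2 * (tau / h ^+ 2) * x <= 1.
  move=> xK; rewrite mulrAC [2 * x * _]mulrA ler_pdivrMr // mul1r mulrC.
  apply: le_trans (ler_wpM2l (ltW htau) xK) _.
  by rewrite -ler_pdivlMr.
rewrite /corner_slack /corner_flux /=.
apply: (@cell_slack_ge0 _ _ _ _ _ (lambda1 k s t) (lambda2 k s t)) => //.
- exact: eigenvalues2_trace (heig k s t).
- exact: eigenvalues2_det (hsym k s t) (heig k s t).
- exact: thetaK.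
- exact: checkerboard_ge0 halpha hgamma (hsym k s t) (heig k s t) l12.
- exact: thetaK.
Qed.
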